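(* Let $p$ be a prime and let $R$ be a finite non-commutative ring such that $R/Z(R)\cong \mathbb{Z}_p\times\mathbb{Z}_p$ (as additive groups). Then $\Gamma_R$ is MSN-integral but not MSN-hyperenergetic.
   Context: Rings are associative and need not have a unity unless stated. For a ring $R$, $Z(R)$ is its center, and $R/Z(R)$ denotes the quotient of additive groups. For a finite non-commutative ring $R$, the commuting graph $\Gamma_R$ is the simple graph with vertex set $R\setminus Z(R)$ in which two distinct vertices are adjacent if they commute. Let $\Gamma$ be a finite simple graph with vertices $v_1,\dots,v_n$. Let $N(v_i)$ be the set of vertices adjacent to $v_i$, let $N^2(v_i)=\big(\bigcup_{u\in N(v_i)}N(u)\big)\setminus\{v_i\}$, and let $\delta_2(v_i)=\sum_{x\in N^2(v_i)}\deg x$. The minimum second neighborhood degree matrix $\mathrm{snm}(\Gamma)$ is the $n\times n$ matrix whose $(i,j)$ entry is $\min\{\delta_2(v_i),\delta_2(v_j)\}$ if $i\neq j$ and $v_i,v_j$ are adjacent, and $0$ otherwise. The MSN-energy $E_{\mathrm{sn}}(\Gamma)$ is the sum of the absolute values of the eigenvalues of $\mathrm{snm}(\Gamma)$, counted with multiplicity. $\Gamma$ is MSN-integral if all eigenvalues of $\mathrm{snm}(\Gamma)$ are integers, and MSN-hyperenergetic if $E_{\mathrm{sn}}(\Gamma)>E_{\mathrm{sn}}(K_n)$, where $K_n$ is the complete graph on $n=|V(\Gamma)|$ vertices. *)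

(* Defs.v *)
From HB Require Import structures.
From mathcomp Require Import all_boot all_order all_fingroup all_algebra all_field.

Set Implicit Arguments.
Unset Strict Implicit.
Unset Printing Implicit Defensive.

Import Order.TTheory GRing.Theory Num.Theory.

Local Open Scope ring_scope.

(* MathComp's rings all have a unit, so finite associative rings that may lack
   one are finite Zmodules with an extra multiplication. *)

HB.mixin Record Zmodule_hasRngMul R of GRing.Zmodule R := {
  rmul : R -> R -> R;
  rmulA : associative rmul;
  rmulDl : left_distributive rmul +%R;
  rmulDr : right_distributive rmul +%R
}.

#[short(type="finRngType")]
HB.structure Definition FinRng :=
  {R of Zmodule_hasRngMul R & FinRing.Zmodule R}.

(* As for the structures of finalg, the finite group of R is its additive
   group. *)
#[non_forgetful_inheritance]
HB.instance Definition _ (R : finRngType) := [finGroupMixin of R for +%R].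
Coercion FinRng_to_baseFinGroup (R : finRngType) := FinStarMonoid.clone R _.
Coercion FinRng_to_finGroup (R : finRngType) := FinGroup.clone R _.

Section RngCenter.
Variable R : finRngType.

Definition rng_center : {set R} :=
  [set z : R | [forall x : R, rmul z x == rmul x z]].

Lemma rng_centerP (z : R) :
  reflect (forall x : R, rmul z x = rmul x z) (z \in rng_center).
Proof. by rewrite inE; apply: 'forall_eqP. Qed.

Lemma rng_center_group_set : group_set rng_center.
Proof.
have addc (x y z : R) : rmul (x + y) z = rmul x z + rmul y z by exact: rmulDl.
have cadd (x y z : R) : rmul z (x + y) = rmul z x + rmul z y by exact: rmulDr.
have mul0 (z : R) : rmul 0 z = 0.
  by apply: (addIr (rmul 0 z)); rewrite -addc !add0r.
have mulz0 (z : R) : rmul z 0 = 0.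
  by apply: (addIr (rmul z 0)); rewrite -cadd !add0r.
apply/group_setP; split=> [|x y /rng_centerP cx /rng_centerP cy].
  by apply/rng_centerP => z; rewrite mul0 mulz0.
by apply/rng_centerP => z; rewrite addc cadd cx cy.
Qed.
Canonical rng_center_group := Group rng_center_group_set.

Definition noncommutative : Prop := ~ commutative (@rmul R).

End RngCenter.

Record sgraph := SGraph {
  svertex :> finType;
  sadj : rel svertex;
  sadj_sym : symmetric sadj;
  sadj_irr : irreflexive sadj
}.

Section CompleteGraph.
Variable n : nat.

Definition complete_adj : rel 'I_n := fun i j => i != j.
Lemma complete_adj_sym : symmetric complete_adj.
Proof. by move=> i j; rewrite /complete_adj eq_sym. Qed.
Lemma complete_adj_irr : irreflexive complete_adj.
Proof. by move=> i; rewrite /complete_adj eqxx. Qed.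
Definition complete_graph := SGraph complete_adj_sym complete_adj_irr.

End CompleteGraph.

Section CommutingGraph.
Variable R : finRngType.

Definition noncentral := {x : R | x \notin rng_center R}.
Definition commuting_adj : rel noncentral :=
  fun x y => (x != y) && (rmul (val x) (val y) == rmul (val y) (val x)).
Lemma commuting_adj_sym : symmetric commuting_adj.
Proof. by move=> x y; rewrite /commuting_adj eq_sym; congr andb; rewrite eq_sym. Qed.
Lemma commuting_adj_irr : irreflexive commuting_adj.
Proof. by move=> x; rewrite /commuting_adj eqxx. Qed.
Definition commuting_graph := SGraph commuting_adj_sym commuting_adj_irr.

End CommutingGraph.

Section MSN.
Variable G : sgraph.

Definition neighbors (v : G) : {set G} := [set u | sadj v u].
Definition degree (v : G) : nat := #|neighbors v|.
Definition neighbors2 (v : G) : {set G} :=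
  (\bigcup_(u in neighbors v) neighbors u) :\ v.
Definition delta2 (v : G) : nat := (\sum_(x in neighbors2 v) degree x)%N.

(* The vertices are ordered by the library's enumeration of G. Over algC, as
   the eigenvalues of an integer matrix are algebraic numbers. *)
Definition snm : 'M[algC]_#|G| :=
  \matrix_(i, j)
    if (i != j) && sadj (enum_val i) (enum_val j)
    then (minn (delta2 (enum_val i)) (delta2 (enum_val j)))%:R else 0.

End MSN.

(* The eigenvalues of A, listed with (algebraic) multiplicity. *)
Definition spectrum (n : nat) (A : 'M[algC]_n) : seq algC :=
  sval (closed_field_poly_normal (char_poly A)).

Lemma char_poly_spectrum (n : nat) (A : 'M[algC]_n) :
  char_poly A = \prod_(a <- spectrum A) ('X - a%:P).
Proof.
rewrite /spectrum; case: closed_field_poly_normal => s /= {1}->.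
by rewrite (monicP (char_poly_monic A)) scale1r.
Qed.

Lemma mem_spectrum (n : nat) (A : 'M[algC]_n) (a : algC) :
  (a \in spectrum A) = eigenvalue A a.
Proof. by rewrite eigenvalue_root_char char_poly_spectrum root_prod_XsubC. Qed.

Definition MSN_energy (G : sgraph) : algC := \sum_(a <- spectrum (snm G)) `|a|.

Definition MSN_integral (G : sgraph) : Prop :=
  forall a : algC, eigenvalue (snm G) a -> a \is a Num.int.

Definition MSN_hyperenergetic (G : sgraph) : Prop :=
  MSN_energy (complete_graph #|G|) < MSN_energy G.

(* Main.v *)
Require Import Defs.
From mathcomp Require Import all_boot all_order all_fingroup all_algebra all_field.
From mathcomp Require Import zify ring.

(* As |R : Z(R)| = p^2, the centralizers of noncentral elements have index p,
   and two of them that share a noncentral element coincide. So the commuting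
   graph is a disjoint union of cliques of the same size m, on which delta_2 is
   a constant d. If E is the 0-1 matrix of "being in the same clique", then
   E^2 = m E and snm = d (E - 1), hence the eigenvalues are -d and (m - 1) d.
   Since the trace is zero, the energy of n vertices is 2 n (m - 1) d / m, which
   increases with m up to its value at m = n, the energy of K_n. *)

Set Implicit Arguments.
Unset Strict Implicit.
Unset Printing Implicit Defensive.

Import Order.TTheory GRing.Theory Num.Theory.

Local Open Scope ring_scope.

(** * Size and sum of the spectrum *)

Lemma size_spectrum (n : nat) (A : 'M[algC]_n) : size (spectrum A) = n.
Proof.
by have := size_char_poly A; rewrite char_poly_spectrum size_prod_XsubC => -[].
Qed.

Lemma sum_spectrum (n : nat) (A : 'M[algC]_n) :
  \sum_(a <- spectrum A) a = \tr A.
Proof.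
(* In positive size, both sides are minus the second leading coefficient of the characteristic
   polynomial. *)
have sz := size_spectrum A; case: n A sz => [|n] A sz.
  by rewrite (size0nil sz) big_nil /mxtrace big_ord0.
apply: oppr_inj; rewrite -char_poly_trace // char_poly_spectrum.
by rewrite -[X in _`_X.-1]sz coefPn_prod_XsubC // sz.
Qed.

(** * Disjoint unions of cliques of equal size *)

Section EqualCliques.
Variables (G : sgraph) (m : nat).

Definition same_clique : rel G := fun u v => (u == v) || sadj u v.

Hypothesis same_clique_trans : transitive same_clique.
Hypothesis card_same_clique : forall v, #|[set u | same_clique v u]| = m.

Lemma same_clique_sym : symmetric same_clique.
Proof. by move=> u v; rewrite /same_clique eq_sym sadj_sym. Qed.

Lemma sadj_same_clique (u v : G) : sadj u v = (u != v) && same_clique u v.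
Proof.
by rewrite /same_clique; case: eqVneq => [->|_] //=; apply: sadj_irr.
Qed.

Lemma clique_neighbors (v : G) : neighbors v = [set u | same_clique v u] :\ v.
Proof. by apply/setP => u; rewrite !inE sadj_same_clique eq_sym. Qed.

Lemma clique_degree (v : G) : degree v = m.-1.
Proof.
have := cardsD1 v [set u | same_clique v u].
rewrite inE /same_clique eqxx card_same_clique -/same_clique.
by rewrite -clique_neighbors => ->.
Qed.

(** A walk of length two between distinct vertices needs a third vertex in their clique. *)
Lemma clique_neighbors2 (v : G) :
  neighbors2 v = if (2 < m)%N then neighbors v else set0.
Proof.
apply/setP => u; rewrite in_setD1; apply/andP/idP.
- move=> [nuv /bigcupP[w]]; rewrite !inE => vw wu.
  have lt2m : (2 < m)%N.
    rewrite -(card_same_clique w).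
    apply: leq_trans (subset_leq_card (A := [set u; v; w]) _).
      rewrite setUAC -setUA !cardsU1 cards1 !inE.
      move: vw wu; rewrite !sadj_same_clique => /andP[vw _] /andP[wu _].
      by rewrite (eq_sym u w) (negPf wu) (negPf nuv) (eq_sym w v) (negPf vw).
    apply/subsetP => x; rewrite !inE => /orP[/orP[]|] /eqP ->.
    + by rewrite /same_clique wu orbT.
    + by rewrite /same_clique sadj_sym vw orbT.
    + by rewrite /same_clique eqxx.
  rewrite lt2m inE sadj_same_clique eq_sym nuv /=.
  by apply: (same_clique_trans (y := w)); rewrite /same_clique ?vw ?wu orbT.
case: ifP => [lt2m|]; last by rewrite inE.
rewrite inE sadj_same_clique => /andP[nvu vu]; split; first by rewrite eq_sym.
(* The degree [m.-1] of [v] is at least 2, so [v] has a neighbor besides [u]. *)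
have [w] : exists w, w \in neighbors v :\ u.
  apply/set0Pn; rewrite -card_gt0.
  have := cardsD1 u (neighbors v); rewrite inE sadj_same_clique nvu vu /=.
  by have := clique_degree v; rewrite /degree; lia.
rewrite !inE => /andP[nwu vw]; apply/bigcupP; exists w; rewrite !inE //.
rewrite sadj_same_clique nwu; apply: (same_clique_trans (y := v)) => //.
by rewrite same_clique_sym /same_clique vw orbT.
Qed.

(* The second neighbourhood in K_1 and K_2 is empty, hence the case split. *)
Definition clique_delta2 (k : nat) : nat := if (2 < k)%N then (k.-1 ^ 2)%N else 0.

Lemma clique_delta2E (v : G) : delta2 v = clique_delta2 m.
Proof.
rewrite /delta2 clique_neighbors2 /clique_delta2; case: ifP => _; last first.
  by rewrite big_set0.
rewrite (eq_bigr _ (fun x _ => clique_degree x)) sum_nat_const.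
by rewrite -/(degree v) clique_degree.
Qed.

Let d : algC := (clique_delta2 m)%:R.

Definition clique_mx : 'M[algC]_#|G| :=
  \matrix_(i, j) (same_clique (enum_val i) (enum_val j))%:R.

(** Entry [(u, v)] of the square counts the vertices in the cliques of both [u] and [v], which are
    equal or disjoint. *)
Lemma clique_mx_sqr : clique_mx *m clique_mx = m%:R *: clique_mx.
Proof.
apply/matrixP => i j; rewrite !mxE; under eq_bigr do rewrite !mxE.
move: (@enum_val _ _ i) (@enum_val _ _ j) => u v.
rewrite -(big_enum_val (A := G)
            (fun w => (same_clique u w)%:R * (same_clique w v)%:R)).
(* Writing [m] as a sum over the clique of [u] allows a comparison term by term. *)
rewrite -(card_same_clique u) -sum1dep_card natr_sum mulr_suml.
rewrite [RHS]big_mkcond /=.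
apply: eq_bigr => w _; case: ifP => [uw|_]; last by rewrite mul0r.
congr (_ * (nat_of_bool _)%:R); apply/idP/idP => [|uv].
  exact: same_clique_trans uw.
by apply: same_clique_trans uv; rewrite same_clique_sym.
Qed.

Lemma snm_clique_mx : snm G = d *: (clique_mx - 1%:M).
Proof.
apply/matrixP => i j; rewrite !mxE !clique_delta2E minnn sadj_same_clique.
rewrite (inj_eq enum_val_inj); case: (eqVneq i j) => [->|_] /=.
  by rewrite /same_clique eqxx subrr mulr0.
by rewrite subr0; case: same_clique; rewrite ?mulr1 ?mulr0.
Qed.

(** The relation for the square of [clique_mx] gives a quadratic in [a] that annihilates an
    eigenvector. Nothing is divided by [d], which is 0 when [m <= 2]. *)
Lemma snm_eigenvalue (a : algC) :
  eigenvalue (snm G) a -> (a == - d) || (a == m%:R * d - d).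
Proof.
move=> /eigenvalueP[v]; rewrite snm_clique_mx => va v0.
have vE : d *: (v *m clique_mx) = (a + d) *: v.
  move: va; rewrite -scalemxAr mulmxBr mulmx1 scalerBr => /eqP.
  by rewrite subr_eq -scalerDl => /eqP.
have wE : (m%:R * d) *: (v *m clique_mx) = (a + d) *: (v *m clique_mx).
  rewrite [RHS]scalemxAl -vE -scalemxAl -mulmxA clique_mx_sqr -scalemxAr.
  by rewrite scalerA mulrC.
have : ((a + d - m%:R * d) * (a + d)) *: v = 0.
  by rewrite -scalerA -vE scalerA mulrC -scalerA scalerBl wE subrr scaler0.
move/eqP; rewrite scaler_eq0 (negPf v0) orbF mulf_eq0 subr_eq0 addr_eq0 orbC.
by rewrite [a == _ - d]eq_sym subr_eq [_ == a + d]eq_sym.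
Qed.

Lemma clique_MSN_integral : MSN_integral G.
Proof.
move=> a /snm_eigenvalue /orP[] /eqP ->.
  by rewrite rpredN rpred_nat.
by rewrite rpredB ?rpredM ?rpred_nat.
Qed.

(* On the two possible eigenvalues the absolute value agrees with an affine
   function, so that the energy follows from the trace, which is zero. *)
Lemma clique_MSN_energy :
  (0 < m)%N -> m%:R * MSN_energy G = (2 * #|G| * m.-1 * clique_delta2 m)%:R.
Proof.
move=> m0.
(* The line through [(-d, m d)] and [((m - 1) d, m (m - 1) d)]; the factor [m] clears the
   denominator of its slope. *)
have affine a : a \in spectrum (snm G) ->
  m%:R * `|a| = (m%:R - 2) * a + (2 * m.-1 * clique_delta2 m)%:R.
  have -> : (2 * m.-1 * clique_delta2 m)%:R = 2 * (m%:R - 1) * d :> algC.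
    by rewrite -subn1 !natrM natrB.
  rewrite mem_spectrum => /snm_eigenvalue /orP[] /eqP ->.
    by rewrite normrN normr_nat -/d; ring.
  rewrite ger0_norm; first by ring.
  by rewrite -{2}[d]mul1r -mulrBl mulr_ge0 ?ler0n // subr_ge0 ler1n.
rewrite /MSN_energy mulr_sumr (eq_big_seq _ affine) big_split /=.
rewrite -mulr_sumr sum_spectrum snm_clique_mx mxtraceZ.
rewrite [\tr _](_ : _ = 0); last first.
  rewrite /mxtrace big1 // => i _.
  by rewrite !mxE /same_clique !eqxx subrr.
rewrite !mulr0 add0r big_const_seq count_predT size_spectrum iter_addr_0.
by rewrite -mulrnA; congr _%:R; ring.
Qed.

End EqualCliques.

(** * Comparison with the complete graph *)

Lemma leq_clique_delta2 : {homo clique_delta2 : k l / (k <= l)%N}.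
Proof.
move=> k l kl; rewrite /clique_delta2; case: ifP => // k2.
by rewrite (leq_trans k2 kl) leq_sqr; lia.
Qed.

Lemma complete_graph_MSN_energy (n : nat) : (0 < n)%N ->
  MSN_energy (complete_graph n) = (2 * n.-1 * clique_delta2 n)%:R.
Proof.
move=> n0.
have all_same (u v : complete_graph n) : same_clique u v.
  by rewrite /same_clique /= /complete_adj orbN.
(* [K_n] is a single clique, so [m = n] and the factor [n] cancels. *)
have := @clique_MSN_energy (complete_graph n) n _ _ n0; rewrite card_ord => E.
have n0' : n%:R != 0 :> algC by rewrite pnatr_eq0 -lt0n.
apply: (mulfI n0'); rewrite E // => [|v].
  by rewrite -natrM; congr _%:R; ring.
by rewrite -[RHS]card_ord -cardsT; apply: eq_card => u; rewrite !inE all_same.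
Qed.

Lemma clique_not_hyperenergetic (G : sgraph) (m : nat) :
  (0 < m)%N -> transitive (@same_clique G) ->
  (forall v : G, #|[set u | same_clique v u]| = m) -> ~ MSN_hyperenergetic G.
Proof.
move=> m0 tr cm; rewrite /MSN_hyperenergetic.
have EG := clique_MSN_energy tr cm m0.
(* The bound [m <= #|G|] needs a vertex; an empty graph has energy 0. *)
case: (posnP #|G|) => [G0|G0].
  have E0 : MSN_energy G = 0.
    by rewrite /MSN_energy (size0nil (etrans (size_spectrum _) G0)) big_nil.
  by rewrite E0 => /(le_lt_trans (sumr_ge0 _ (fun a _ => normr_ge0 a))); rewrite ltxx.
have mG : (m <= #|G|)%N.
  by move/card_gt0P: G0 => [v _]; rewrite -(cm v) max_card.
have mR0 : 0 < m%:R :> algC by rewrite ltr0n.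
rewrite complete_graph_MSN_energy // -(ltr_pM2l mR0) EG -natrM ltr_nat.
apply/negP; rewrite -leqNgt.
have := leq_clique_delta2 mG.
move: (clique_delta2 m) (clique_delta2 _) => x y xy.
have lin : (#|G| * m.-1 <= m * #|G|.-1)%N.
  by rewrite -!subn1 !mulnBr !muln1 mulnC leq_sub2l.
by rewrite mulnA mulnCA leq_mul // -mulnA leq_mul2l lin.
Qed.

(** * Centralizers as additive subgroups *)

Section Centralizers.
Variable R : finRngType.

Definition rng_cent (x : R) : {set R} := [set y | rmul x y == rmul y x].

Lemma rng_cent_group_set (x : R) : group_set (rng_cent x).
Proof.
have z0 : rmul x 0 = 0 by apply: (addIr (rmul x 0)); rewrite -rmulDr !add0r.
have z1 : rmul 0 x = 0 by apply: (addIr (rmul 0 x)); rewrite -rmulDl !add0r.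
apply/group_setP; split=> [|y z].
  by rewrite inE z0 z1.
by rewrite !inE => /eqP cy /eqP cz; rewrite rmulDr rmulDl cy cz.
Qed.
Canonical rng_cent_group (x : R) := Group (rng_cent_group_set x).

Lemma rng_center_sub_cent (x : R) : rng_center R \subset rng_cent x.
Proof. by apply/subsetP => z /rng_centerP cz; rewrite inE cz. Qed.

Lemma mem_rng_cent (x : R) : x \in rng_cent x.
Proof. by rewrite inE. Qed.

Lemma rng_cent_sym (x y : R) : (x \in rng_cent y) = (y \in rng_cent x).
Proof. by rewrite !inE eq_sym. Qed.

Lemma rng_cent_proper (x : R) :
  x \notin rng_center R -> rng_cent x \proper [set: R].
Proof.
apply: contraR; rewrite properT negbK => /eqP cx; apply/rng_centerP => y.
by apply/eqP; have := in_setT y; rewrite -cx inE.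
Qed.

End Centralizers.

(** * Rings whose center has index [p ^ 2] *)

Section IndexPSquare.
Variables (p : nat) (R : finRngType).
Hypothesis p_pr : prime p.
Hypothesis card_R : #|R| = (p ^ 2 * #|rng_center R|)%N.

(** The index of the center in [H] divides [p ^ 2], and the strict inclusions exclude 1 and
    [p ^ 2]. *)
Lemma card_intermediate (H : {group R}) :
  rng_center R \proper H -> H \proper [set: R] -> #|H| = (p * #|rng_center R|)%N.
Proof.
move=> pZH pHR.
have /dvdnP[k Hk] := cardSg (proper_sub pZH).
have := cardSg (proper_sub pHR); rewrite cardsT card_R Hk.
have Z0 : (0 < #|rng_center R|)%N := cardG_gt0 _.
rewrite dvdn_pmul2r // => /(dvdn_pfactor _ _ p_pr)[e le_e2 ke].
have := proper_card pZH; have := proper_card pHR.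
rewrite cardsT card_R Hk ltn_pmul2r // -{1}[#|rng_center R|]mul1n ltn_pmul2r // ke.
by case: e le_e2 {ke} => [|[|[|]]] // _; rewrite ?ltnn ?expn1.
Qed.

Lemma card_rng_cent (x : R) :
  x \notin rng_center R -> #|rng_cent x| = (p * #|rng_center R|)%N.
Proof.
move=> xZ; apply: (card_intermediate (H := rng_cent_group x)) (rng_cent_proper xZ).
by apply/properP; split; [exact: rng_center_sub_cent | exists x => //; exact: mem_rng_cent].
Qed.

(* Both centralizers contain [y], so their intersection is already strictly
   larger than the center. *)
Lemma rng_cent_eq (x y : R) :
  x \notin rng_center R -> y \notin rng_center R -> y \in rng_cent x ->
  rng_cent x = rng_cent y.
Proof.
move=> xZ yZ yx.
have cI : #|rng_cent x :&: rng_cent y| = (p * #|rng_center R|)%N.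
  apply: (card_intermediate (H := (rng_cent_group x :&: rng_cent_group y)%G)).
    apply/properP; split; first by rewrite subsetI !rng_center_sub_cent.
    by exists y => //; rewrite inE yx mem_rng_cent.
  exact: sub_proper_trans (subsetIl _ _) (rng_cent_proper xZ).
have capx : rng_cent x :&: rng_cent y = rng_cent x.
  by apply/eqP; rewrite eqEcard subsetIl cI card_rng_cent /=.
by rewrite -capx; apply/eqP; rewrite eqEcard subsetIr cI card_rng_cent /=.
Qed.

Lemma commuting_same_cliqueE (x y : commuting_graph R) :
  same_clique x y = (val y \in rng_cent (val x)).
Proof.
rewrite /same_clique /= /commuting_adj inE.
by case: (eqVneq x y) => [->|_] //=; rewrite eqxx.
Qed.

Lemma commuting_same_clique_trans : transitive (@same_clique (commuting_graph R)).
Proof.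
move=> y x z; rewrite !commuting_same_cliqueE => xy.
by rewrite (rng_cent_eq (valP x) (valP y)).
Qed.

Lemma card_commuting_same_clique (x : commuting_graph R) :
  #|[set y | same_clique x y]| = (p.-1 * #|rng_center R|)%N.
Proof.
(* Seen in [R], the clique of [x] is its centralizer without the center. *)
have -> : #|[set y | same_clique x y]| = #|rng_cent (val x) :\: rng_center R|.
  rewrite -(card_imset _ val_inj); apply: eq_card => y.
  rewrite inE; apply/imsetP/andP => [[z]|[yZ yx]].
    by rewrite inE commuting_same_cliqueE => zx ->; split=> //; exact: (valP z).
  by exists (Sub y yZ); rewrite ?inE ?commuting_same_cliqueE.
rewrite cardsD (setIidPr (rng_center_sub_cent _)) (card_rng_cent (valP x)).
by rewrite -[X in (_ - X)%N]mul1n -mulnBl subn1.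
Qed.

End IndexPSquare.

Theorem theorem2p5 (p : nat) (hp : prime p) (R : finRngType)
    (hR : noncommutative R)
    (hZ : ([set: R] / rng_center R \isog [set: 'Z_p * 'Z_p])%g) :
  MSN_integral (commuting_graph R) /\ ~ MSN_hyperenergetic (commuting_graph R).
Proof.
have card_R : #|R| = (p ^ 2 * #|rng_center R|)%N.
  have nZ : ([set: R] \subset 'N(rng_center R))%g.
    by apply/sub_abelian_norm; [apply/centsP => x _ y _; exact: addrC | exact: subsetT].
  have := card_isog hZ; rewrite card_quotient //.
  (* ['Z_p] has [(Zp_trunc p).+2] elements by definition, which is [p] because [1 < p]. *)
  rewrite cardsT card_prod !card_ord Zp_cast ?prime_gt1 // mulnn => idx.
  by rewrite -idx mulnC -cardsT Lagrange // subsetT.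
have tr := commuting_same_clique_trans hp card_R.
have cm := card_commuting_same_clique hp card_R.
split; first exact: clique_MSN_integral tr cm.
apply: clique_not_hyperenergetic tr cm.
by rewrite muln_gt0 cardG_gt0 andbT -subn1 subn_gt0 prime_gt1.
Qed.
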